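(* Let $\mathcal{C}$ be a Melnikov formation of finite groups. A pro-$\mathcal{C}$ group $\Lambda$ is $\mathcal{C}$-projective if and only if the pair $(1,\Lambda)$ is $\mathcal{C}$-projective.
   Context: A Melnikov formation $\mathcal{C}$ is a family of finite groups closed under fiber products (with respect to epimorphisms) and such that for every short exact sequence $1\to A\to B\to C\to 1$ one has $A,C\in\mathcal{C}$ if and only if $B\in\mathcal{C}$. A pro-$\mathcal{C}$ group is a profinite group all of whose finite continuous quotients are in $\mathcal{C}$. All subgroups of profinite groups are closed and all homomorphisms are continuous. A pro-$\mathcal{C}$ group $\Lambda$ is $\mathcal{C}$-projective if for all $G,A\in\mathcal{C}$ and all epimorphisms $\mu\colon\Lambda\to A$, $\alpha\colon G\to A$ there is a homomorphism $\theta\colon\Lambda\to G$ with $\alpha\theta=\mu$. Let $\Gamma\le\Lambda$ be pro-$\mathcal{C}$ groups. A $\mathcal{C}$-DEP ($\mathcal{C}$ double embedding problem) for $(\Gamma,\Lambda)$ consists of groups $A\le B$ and $G\le H$, all in $\mathcal{C}$, and epimorphisms $\mu\colon\Gamma\to A$, $\alpha\colon G\to A$, $\nu\colon\Lambda\to B$, $\beta\colon H\to B$ such that $\nu|_\Gamma=\mu$ and $\beta|_G=\alpha$. A weak solution is a pair $(\eta,\theta)$ of homomorphisms $\eta\colon\Gamma\to G$, $\theta\colon\Lambda\to H$ (not necessarily surjective) with $\alpha\eta=\mu$, $\beta\theta=\nu$ and $\theta|_\Gamma=\eta$. The pair $(\Gamma,\Lambda)$ is $\mathcal{C}$-projective if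 every $\mathcal{C}$-DEP for it has a weak solution. *)

(* Defs.v *)
From HB Require Import structures.
From mathcomp Require Import all_boot all_fingroup.
From mathcomp Require Import all_classical topology.

Set Implicit Arguments.
Unset Strict Implicit.
Unset Printing Implicit Defensive.

Local Open Scope classical_set_scope.
Local Open Scope group_scope.

(** A family of finite groups.  Finite groups are subgroups [G : {group gT}] of
    an ambient [gT : finGroupType]; invariance under isomorphism is not built in,
    it follows from [melnikov_exact]. *)
Definition group_family := forall gT : finGroupType, {group gT} -> Prop.

Section FiberProduct.
Variables (gT hT aT : finGroupType) (G : {group gT}) (H : {group hT}).
Variables (f : {morphism G >-> aT}) (g : {morphism H >-> aT}).

Definition fiber_prod : {set gT * hT} :=
  finset (fun x => [&& x.1 \in G, x.2 \in H & f x.1 == g x.2]).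

Lemma group_set_fiber_prod : group_set fiber_prod.
Proof.
apply/group_setP; split=> [|x y]; first by rewrite inE !group1 !morph1 /=.
rewrite !inE => /and3P[Gx Hx /eqP exy] /and3P[Gy Hy /eqP eyy] /=.
by rewrite !groupM //= !morphM // exy eyy.
Qed.

Canonical fiber_prod_group := Group group_set_fiber_prod.

End FiberProduct.

Definition short_exact (aT bT cT : finGroupType) (A : {group aT})
    (B : {group bT}) (C : {group cT})
    (i : {morphism A >-> bT}) (p : {morphism B >-> cT}) : Prop :=
  [/\ 'injm i, i @* A = 'ker p & p @* B = C].

Record melnikov_formation (C : group_family) : Prop := MelnikovFormation {
  melnikov_fiber_prod : forall (gT hT aT : finGroupType)
      (G : {group gT}) (H : {group hT}) (A : {group aT})
      (f : {morphism G >-> aT}) (g : {morphism H >-> aT}),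
    C gT G -> C hT H -> C aT A -> f @* G = A -> g @* H = A ->
    C _ (fiber_prod_group f g);
  melnikov_exact : forall (aT bT cT : finGroupType)
      (A : {group aT}) (B : {group bT}) (Q : {group cT})
      (i : {morphism A >-> bT}) (p : {morphism B >-> cT}),
    short_exact Q i p -> (C aT A /\ C cT Q <-> C bT B)
}.

HB.mixin Record isProfinite L & monoid.Group L & Topological L := {
  profinite_mul_continuous : continuous (fun x : L * L => x.1 * x.2 : L);
  profinite_inv_continuous : continuous (fun x : L => x^-1 : L);
  profinite_compact : compact [set: L];
  profinite_hausdorff : hausdorff_space L;
  profinite_totally_disconnected : totally_disconnected [set: L]
}.

#[short(type="profiniteGroupType")]
HB.structure Definition ProfiniteGroup :=
  { L of monoid.Group L & Topological L & isProfinite L }.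

Record closed_subgroup (L : profiniteGroupType) := ClosedSubgroup {
  carrier :> set L;
  closed_subgroup_closed : closed carrier;
  closed_subgroup1 : carrier 1;
  closed_subgroupM : forall x y,
    carrier x -> carrier y -> carrier (x * y);
  closed_subgroupV : forall x,
    carrier x -> carrier x^-1
}.

Definition full_subgroup (L : profiniteGroupType) : closed_subgroup L :=
  @ClosedSubgroup L setT closedT I (fun _ _ _ _ => I) (fun _ _ => I).

Section TrivialSubgroup.
Variable L : profiniteGroupType.

Lemma trivial_closed : closed [set 1 : L].
Proof.
by apply: accessible_closed_set1; apply: hausdorff_accessible;
  exact: profinite_hausdorff.
Qed.

Lemma trivialM (x y : L) :
  [set 1 : L] x -> [set 1 : L] y -> [set 1 : L] (x * y).
Proof. by move=> /= -> ->; rewrite mulg1. Qed.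

Lemma trivialV (x : L) : [set 1 : L] x -> [set 1 : L] x^-1.
Proof. by move=> /= ->; rewrite invg1. Qed.

Definition trivial_subgroup : closed_subgroup L :=
  ClosedSubgroup trivial_closed erefl trivialM trivialV.

End TrivialSubgroup.

(** Continuous homomorphisms from a closed subgroup [D] of [L] (with the subspace
    topology) to a finite discrete group [G].  As for [{morphism _ >-> _}], the
    underlying function is total, but its values outside [D] are irrelevant. *)
Record chom (L : profiniteGroupType) (D : closed_subgroup L)
    (gT : finGroupType) (G : {group gT}) := CHom {
  chom_fun :> L -> gT;
  chom_range : forall x, carrier D x -> chom_fun x \in G;
  chomM : forall x y, carrier D x -> carrier D y -> chom_fun (x * y) = chom_fun x * chom_fun y;
  chom_continuous : {within D, continuous (chom_fun : L -> discrete_topology gT)}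
}.

Definition epi (L : profiniteGroupType) (D : closed_subgroup L)
    (gT : finGroupType) (G : {group gT}) (f : chom D G) : Prop :=
  f @` D = [set` G].

Definition pro (C : group_family) (L : profiniteGroupType)
    (D : closed_subgroup L) : Prop :=
  forall (gT : finGroupType) (G : {group gT}) (f : chom D G), epi f -> C gT G.

Definition projective (C : group_family) (L : profiniteGroupType) : Prop :=
  forall (gT aT : finGroupType) (G : {group gT}) (A : {group aT}),
    C gT G -> C aT A ->
  forall (mu : chom (full_subgroup L) A) (alpha : {morphism G >-> aT}),
    epi mu -> alpha @* G = A ->
  exists theta : chom (full_subgroup L) G, forall x, alpha (theta x) = mu x.

Record DEP (C : group_family) (L : profiniteGroupType)
    (Gamma : closed_subgroup L) := MkDEP {
  dep_bT : finGroupType;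
  dep_hT : finGroupType;
  dep_A : {group dep_bT};
  dep_B : {group dep_bT};
  dep_G : {group dep_hT};
  dep_H : {group dep_hT};
  dep_sAB : dep_A \subset dep_B;
  dep_sGH : dep_G \subset dep_H;
  dep_CA : C dep_bT dep_A;
  dep_CB : C dep_bT dep_B;
  dep_CG : C dep_hT dep_G;
  dep_CH : C dep_hT dep_H;
  dep_mu : chom Gamma dep_A;
  dep_alpha : {morphism dep_G >-> dep_bT};
  dep_nu : chom (full_subgroup L) dep_B;
  dep_beta : {morphism dep_H >-> dep_bT};
  dep_mu_epi : epi dep_mu;
  dep_alpha_epi : dep_alpha @* dep_G = dep_A;
  dep_nu_epi : epi dep_nu;
  dep_beta_epi : dep_beta @* dep_H = dep_B;
  dep_nu_mu : forall x, carrier Gamma x -> dep_nu x = dep_mu x;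
  dep_beta_alpha : forall y, y \in dep_G -> dep_beta y = dep_alpha y
}.

Definition weak_solution (C : group_family) (L : profiniteGroupType)
    (Gamma : closed_subgroup L) (P : DEP C Gamma)
    (eta : chom Gamma (dep_G P)) (theta : chom (full_subgroup L) (dep_H P))
    : Prop :=
  [/\ forall x, carrier Gamma x -> dep_alpha P (eta x) = dep_mu P x,
      forall x, dep_beta P (theta x) = dep_nu P x
    & forall x, carrier Gamma x -> theta x = eta x].

Definition projective_pair (C : group_family) (L : profiniteGroupType)
    (Gamma : closed_subgroup L) : Prop :=
  forall P : DEP C Gamma, exists eta theta, weak_solution (P := P) eta theta.

(** The standing assumption that both members of a pair are pro-[C] holds for
    [(1, L)] as soon as [L] is pro-[C]. *)
Lemma pro_trivial_subgroup (C : group_family) (L : profiniteGroupType) :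
  pro C (full_subgroup L) -> pro C (trivial_subgroup L).
Proof.
move=> proL gT G f epif.
have G1 x : x \in G -> x = 1.
  move=> Gx; have : (f @` trivial_subgroup L) x by rewrite epif.
  case=> _ /= -> <-; apply: (@mulgI _ (f 1)); rewrite mulg1.
  by rewrite -(chomM f) // mulg1.
have h1 : {within full_subgroup L,
    continuous ((fun _ : L => 1) : L -> discrete_topology gT)}.
  by apply: continuous_subspaceT => x; exact: cvg_cst.
pose t := @CHom L (full_subgroup L) gT G (fun=> 1) (fun _ _ => group1 G)
  (fun _ _ _ _ => esym (mulg1 1)) h1.
apply: (proL gT G t); apply/seteqP; split=> [_ [x _ <-]|x Gx] /=.
  exact: group1.
by exists 1 => //=; rewrite (G1 x).
Qed.

(* Main.v *)
Require Import Defs.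
From HB Require Import structures.
From mathcomp Require Import all_boot all_fingroup.
From mathcomp Require Import all_classical topology.

Set Implicit Arguments.
Unset Strict Implicit.
Unset Printing Implicit Defensive.

Local Open Scope classical_set_scope.
Local Open Scope group_scope.

(** A homomorphism is forced at the identity, so over the trivial subgroup a double embedding
    problem reduces to its upper row [(dep_nu, dep_beta)], an ordinary embedding problem for [L].
    Conversely, an ordinary problem becomes a double one by adding a row of trivial groups below it.
    [projective_pair_trivial] and [projective_of_pair] carry the two directions. *)

Lemma chom1 (L : profiniteGroupType) (D : closed_subgroup L)
    (gT : finGroupType) (G : {group gT}) (f : chom D G) : f 1 = 1.
Proof.
have D1 := closed_subgroup1 D.
by apply: (@mulgI _ (f 1)); rewrite -(chomM f) // !mulg1.
Qed.

Section TrivialHom.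
Variables (L : profiniteGroupType) (D : closed_subgroup L).
Variables (gT : finGroupType) (G : {group gT}).

Lemma chom_one_continuous :
  {within D, continuous ((fun _ : L => 1) : L -> discrete_topology gT)}.
Proof. by apply: continuous_subspaceT => x; exact: cvg_cst. Qed.

Definition chom_one : chom D G :=
  CHom (fun _ _ => group1 G) (fun _ _ _ _ => esym (mulg1 1))
    chom_one_continuous.

End TrivialHom.

Lemma epi_chom_one (L : profiniteGroupType) (D : closed_subgroup L)
    (gT : finGroupType) : epi (chom_one D [1 gT]%G).
Proof.
apply/seteqP; split=> [_ [x _ <-]|x /=]; first exact: group1.
by move=> /set1P ->; exists 1 => //; exact: closed_subgroup1.
Qed.

(** The trivial group is a continuous quotient of any [D]; this puts the added lower row in [C]. *)
Lemma pro_group1 (C : group_family) (L : profiniteGroupType)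
    (D : closed_subgroup L) (gT : finGroupType) : pro C D -> C gT [1 gT]%G.
Proof. by move=> proD; exact: proD (epi_chom_one D gT). Qed.

Lemma projective_pair_trivial (C : group_family) (L : profiniteGroupType) :
  projective C L -> projective_pair C (trivial_subgroup L).
Proof.
move=> projL P.
have [theta thetaP] := projL _ _ _ _ (dep_CH P) (dep_CB P) _ _
  (dep_nu_epi P) (dep_beta_epi P).
(* [dep_G P] may be nontrivial, but both conditions on [Gamma] concern only [x = 1], so the trivial
   [eta] is compatible with any [theta]. *)
exists (chom_one _ _), theta; split=> [x|//|x] /= ->; last exact: chom1.
by rewrite morph1 chom1.
Qed.

Lemma projective_of_pair (C : group_family) (L : profiniteGroupType) :
  pro C (full_subgroup L) -> projective_pair C (trivial_subgroup L) ->
  projective C L.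
Proof.
move=> proL projP gT aT G A CG CA mu alpha mu_epi alpha_epi.
have triv1 : trivm [1 gT] @* [1 gT] = [1 aT] by exact: morphim1.
have mu1 x : carrier (trivial_subgroup L) x ->
    mu x = chom_one (trivial_subgroup L) [1 aT]%G x.
  by move=> /= ->; exact: chom1.
have alpha1 y : y \in [1 gT] -> alpha y = trivm [1 gT] y.
  by move=> /set1P ->; rewrite !morph1.
(* The given problem [(mu, alpha)] is the upper row, over trivial subgroups of [A] and [G]; only the
   [theta] part of the weak solution is kept. *)
have [_ [theta [_ thetaP _]]] := projP (MkDEP (sub1G A) (sub1G G)
  (pro_group1 aT proL) CA (pro_group1 gT proL) CG
  (epi_chom_one (trivial_subgroup L) aT) triv1 mu_epi alpha_epi mu1 alpha1).
by exists theta.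
Qed.

Theorem proposition2p4 (C : group_family) (hC : melnikov_formation C)
    (Lambda : profiniteGroupType) (hLambda : pro C (full_subgroup Lambda)) :
  projective C Lambda <-> projective_pair C (trivial_subgroup Lambda).
Proof.
by split; [exact: projective_pair_trivial | exact: projective_of_pair].
Qed.
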